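(* Let $G$ be a nonabelian finite group of odd order. Then $\operatorname{anz}(G)<16/11$ if and only if $G$ is (isomorphic to) the Frobenius group of order $3\cdot7$, $3\cdot13$, $3\cdot19$ or $5\cdot11$.
   Context: For a finite group $G$, $\operatorname{Irr}(G)$ is the set of complex irreducible characters and $\operatorname{Cl}(G)$ the set of conjugacy classes. The average number of zeros in a row of the character table of $G$ is $$\operatorname{anz}(G)=\frac{|\{(g^G,\chi)\in\operatorname{Cl}(G)\times\operatorname{Irr}(G)\mid\chi(g)=0\}|}{|\operatorname{Irr}(G)|}.$$ *)

(* Defs.v *)
From HB Require Import structures.
From mathcomp Require Import all_boot all_order all_algebra all_fingroup.
From mathcomp Require Import all_solvable all_field all_character.

Set Implicit Arguments.
Unset Strict Implicit.
Unset Printing Implicit Defensive.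

Import Order.TTheory GRing.Theory Num.Theory GroupScope.
Local Open Scope ring_scope.

(* [Iirr G] indexes [irr G] without repetition, so it stands for Irr(G); the
   value of a character on a class [C] is read off at the element [repr C]. *)
Definition zero_entries (gT : finGroupType) (G : {group gT}) :
    {set {set gT} * Iirr G} :=
  [set Ci | (Ci.1 \in classes G) && ('chi[G]_(Ci.2) (repr Ci.1) == 0)].

Definition anz (gT : finGroupType) (G : {group gT}) : rat :=
  #|zero_entries G|%:R / #|Iirr G|%:R.

Section FrobeniusUniqueness.

Local Open Scope nat_scope.

Variables (q p : nat).
Hypotheses (pr_q : prime q) (pr_p : prime p) (lt_qp : q < p).

Let factors_eq k h : k * h = q * p -> 1 < h -> h < k -> k = p /\ h = q.
Proof.
move=> E h1 hk; have q0 := prime_gt0 pr_q; have p0 := prime_gt0 pr_p.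
have: p %| k * h by rewrite E dvdn_mull.
rewrite Euclid_dvdM // => /orP[|] /dvdnP[m Dm].
  have Dq : m * h = q by apply/eqP; rewrite -(eqn_pmul2r p0) -E Dm mulnAC.
  have Dh: h = q.
    by apply/(prime_nt_dvdP pr_q); rewrite ?neq_ltn ?h1 ?orbT // -Dq dvdn_mull.
  have : m = 1 by apply/eqP; rewrite -(eqn_pmul2r q0) mul1n -{1}Dh Dq.
  by move=> m1; rewrite Dm m1 mul1n.
have Dq : k * m = q by apply/eqP; rewrite -(eqn_pmul2r p0) -E Dm mulnA.
have kq : k <= q by rewrite dvdn_leq // -Dq dvdn_mulr.
have ph : p <= h by rewrite dvdn_leq // ?(ltnW h1) // Dm dvdn_mull.
have := leq_trans (leq_ltn_trans ph hk) kq.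
by rewrite ltnNge (ltnW lt_qp).
Qed.

Let conj_cycleX (gT : finGroupType) (x y : gT) a n :
  (x ^ y = x ^+ a -> x ^ (y ^+ n) = x ^+ (a ^ n))%g.
Proof.
move=> Dxy; elim: n => [|n IHn]; first by rewrite conjg1.
by rewrite expgSr conjgM IHn conjXg Dxy -expgM expnS.
Qed.

Let Frobenius_generators (gT : finGroupType) (G : {group gT}) :
    [Frobenius G] -> #|G| = q * p ->
  exists x : gT, exists y : gT, exists a : nat,
    [/\ <[x]> ><| <[y]> = G, #[x] = p /\ #[y] = q, (x ^ y = x ^+ a)%g,
        a != 1 %[mod p] & a ^ q == 1 %[mod p]].
Proof.
case/existsP=> H /Frobenius_kernel_exists[K frobG] oG.
have [defG ntK ntH _ _] := Frobenius_context frobG.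
have K_gt1 : 1 < #|K| by rewrite cardG_gt1.
have H_gt1 : 1 < #|H| by rewrite cardG_gt1.
have ltHK : #|H| < #|K|.
  have := dvdn_leq _ (Frobenius_dvd_ker1 frobG).
  rewrite -(ltnS #|H|) prednK ?cardG_gt0 //; apply.
  by rewrite -ltnS prednK ?cardG_gt0.
have [|oK oH] := factors_eq _ H_gt1 ltHK; first by rewrite (sdprod_card defG).
have /cyclicP[x Dx] : cyclic K by rewrite prime_cyclic ?oK.
have /cyclicP[y Dy] : cyclic H by rewrite prime_cyclic ?oH.
have ox : #[x] = p by rewrite orderE -Dx.
have oy : #[y] = q by rewrite orderE -Dy.
have /cycleP[a Dxy] : (x ^ y \in <[x]>)%g.
  have [_ _ nKH _] := sdprodP defG.
  by rewrite -Dx memJ_norm ?(subsetP nKH) ?Dx ?Dy ?cycle_id.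
exists x, y, a; split=> //; first by rewrite -Dx -Dy.
  apply: contraTneq K_gt1 => a1; rewrite -leqNgt leq_eqVlt -trivg_card1.
  have regK := Frobenius_reg_ker frobG.
  have yH : y \in H^#.
    by rewrite !inE -order_eq1 oy neq_ltn (prime_gt1 pr_q) orbT Dy cycle_id.
  have x1 : x \in 'C_K[y].
    rewrite inE Dx cycle_id; apply/cent1P/commgP/conjg_fixP.
    by rewrite Dxy; apply/eqP; rewrite -{2}[x]expg1 eq_expg_mod_order ox a1.
  by move: x1; rewrite regK // inE Dx => /eqP->; rewrite cycle1 eqxx.
rewrite -ox -eq_expg_mod_order -(conj_cycleX _ Dxy) -oy expg_order.
by rewrite conjg1 expg1.
Qed.

(* This is what licenses "the" Frobenius group of order [q * p]. *)
Lemma Frobenius_isog (gT rT : finGroupType) (G : {group gT}) (L : {group rT}) :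
    [Frobenius G] -> #|G| = q * p -> [Frobenius L] -> #|L| = q * p ->
  L \isog G.
Proof.
move=> frobG oG frobL oL.
have [x [y [a [defG [ox oy] Dxy a1 aq]]]] := Frobenius_generators frobG oG.
have [u [v [b [defL [ou ov] Duv b1 bq]]]] := Frobenius_generators frobL oL.
have natFp m n : ((m%:R : 'F_p) == n%:R)%R = (m == n %[mod p]).
  by rewrite -val_eqE /= !val_Fp_nat.
have [|m prim_b m_q] := @prim_order_exists 'F_p q b%:R%R (prime_gt0 pr_q).
  by apply/eqP; rewrite -natrX (natFp _ 1).
have Dm : m = q.
  apply/(prime_nt_dvdP pr_q) => //; apply: contraNneq b1 => m1.
  by move: (prim_expr_order prim_b); rewrite m1 expr1 -(natFp _ 1) => ->.
rewrite {m m_q}Dm in prim_b.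
have [|i Dab] := @prim_rootP _ _ _ prim_b (a%:R)%R.
  by apply/eqP; rewrite -natrX (natFp _ 1).
have {}Dab : a == b ^ i %[mod p] by rewrite -natFp natrX Dab.
have Duw : (u ^ (v ^+ i) = u ^+ a)%g.
  by rewrite (conj_cycleX _ Duv); apply/eqP; rewrite eq_expg_mod_order ou eq_sym.
have ow : #[(v ^+ i)%g] = q.
  apply/(prime_nt_dvdP pr_q); last by have := orderXdvd v i; rewrite [in X in _ %| X]ov.
  apply: contraNneq a1 => w1'; have w1 : (v ^+ i = 1)%g by apply/eqP; rewrite -order_eq1 w1'.
  by rewrite -ou -eq_expg_mod_order -Duw w1 conjg1 expg1.
have Dw : <[(v ^+ i)%g]> = <[v]>.
  by apply/eqP; rewrite eqEcard cycleX -!orderE ow ov /=.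
have dvd_ux : #[u] %| #[x] by rewrite ou ox.
have dvd_wy : #[(v ^+ i)%g] %| #[y] by rewrite ow oy.
have actf : {in <[x]> & <[y]>, morph_act 'J 'J (eltm dvd_ux) (eltm dvd_wy)}.
  move=> _ _ /cycleP[m ->] /cycleP[n ->] /=.
  rewrite conjXg (conj_cycleX _ Dxy) -expgM !eltmE.
  by rewrite conjXg (conj_cycleX _ Duw) -expgM.
rewrite isogEcard oG oL leqnn andbT; apply/homgP.
exists (sdprodm_morphism defG actf).
by rewrite /= im_sdprodm !im_eltm Dw; have [_ ->] := sdprodP defL.
Qed.

End FrobeniusUniqueness.

(* Main.v *)
Require Import Defs.
From mathcomp Require Import all_boot all_order all_algebra all_fingroup.
From mathcomp Require Import all_solvable all_field all_character.
From mathcomp Require Import zify.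

Set Implicit Arguments.
Unset Strict Implicit.
Unset Printing Implicit Defensive.

Import Order.TTheory GRing.Theory Num.Theory GroupScope.
Local Open Scope ring_scope.

(** Let [l] be the index of the derived subgroup, and let the linear
    characters act on the irreducible ones by multiplication. The hypothesis
    [anz G < 16 / 11] says that the sum of [11 * z - 16] over the nonlinear
    characters is less than [16 * l], where [z] is the number of classes on
    which the character vanishes. Two lower bounds for [z] are available.
    - In odd order [z >= 2]: Burnside gives a zero [x] of any nonlinear
      character, and [x^-1] is another, not conjugate to it ([nzeros_ge2]).
    - A character in an orbit of length [t] vanishes off the common kernel of
      the linear characters that fix it, and this gives [z >= l - t]
      ([nzeros_lin_orbit]).

    Zeros are constant on an orbit, so an orbit of length [t] contributes [t]
    equal terms. This excludes orbits with [1 < t < l] at once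
    ([lin_orbit_trivial]). A regular orbit and its complex conjugate, which
    differ in odd order, would exhaust the nonlinear characters; their common
    degree [d] would then divide [#|G^`(1)| = 1 + 2 * d ^ 2], which is absurd
    ([no_regular_orbit]). So linear characters fix every nonlinear one. Thus
    nonlinear characters vanish off the derived subgroup [N], [z >= l - 1],
    and counting leaves [l = 3] with at most 7 nonlinear characters, or
    [l = 5] or [l = 7] with two ([few_nonlinear]). Centralisers of elements
    outside [N] have prime order [l], so [G] is a Frobenius group with kernel
    [N] and complement of order [l].

    It remains to find [#|N|]. If there are two nonlinear characters, then
    [#|N| = 1 + 2 * l], and 15 is impossible as an element of order 3 of [N]
    would be central in [G]. If [l = 3], elements outside [N] have cube 1; an
    elementary computation shows that each element of [N] commutes with its
    conjugates in [N], so [N] is nilpotent ([cube_nilpotent]). Its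
    abelianisation has order 1, 7, 13 or 19, so [N] is cyclic of that order.

    Conversely, in a Frobenius group of order [q * p] with primes [q < p], the
    [(p - 1) / q] nonlinear characters have degree [q]. They vanish off the
    kernel, which has order [p], and by Galois conjugation they vanish nowhere
    on it: each of them has at most [q - 1] zeros. *)

(** * Real elements and characters in odd order *)

(** An element of odd order is a power of its square. *)
Lemma odd_mem_sqr (gT : finGroupType) (G H : {group gT}) z :
  odd #|G| -> z \in G -> (z ^+ 2)%g \in H -> z \in H.
Proof.
move=> oddG Gz Hz2; have: <[z ^+ 2]>%g \subset H by rewrite cycle_subG.
suff /eqP<-: generator <[z]> (z ^+ 2)%g by rewrite cycle_subG.
rewrite generator_coprime coprimen2.
by rewrite (dvdn_odd (order_dvdG Gz)).
Qed.

(** If [y] inverts [x], then its square centralises [x]; hence so does [y], and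
    [x] is an involution or trivial. *)
Lemma odd_real_elt (gT : finGroupType) (G : {group gT}) x :
  odd #|G| -> x \in G -> (x^-1)%g \in x ^: G -> x = 1%g.
Proof.
move=> oddG Gx /imsetP[y Gy Dxy].
have /cent1P/commute_sym/commgP/conjg_fixP cxy: y \in 'C[x].
  apply: (odd_mem_sqr oddG Gy); apply/cent1P/commute_sym/commgP/conjg_fixP.
  by rewrite expgS expg1 conjgM -Dxy conjVg -Dxy invgK.
rewrite -Dxy in cxy.
apply/set1P; apply: (@odd_mem_sqr _ G 1%G) => //=.
by rewrite inE expgS expg1 -{1}cxy mulVg.
Qed.

(** The orbits of the involution have two elements, on which the summand takes
    the same value; ranks in the enumeration of [T] choose one of the two. *)
Lemma sum_fpf_involution (T : finType) (R : nmodType) (A : {pred T})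
    (f : T -> T) (F : T -> R) :
    {in A, forall x, [/\ f x \in A, f (f x) = x, f x != x & F (f x) = F x]} ->
  exists B : {set T}, \sum_(x in A) F x = (\sum_(x in B) F x) *+ 2.
Proof.
move=> fP; pose r (x : T) := enum_rank x.
pose B := [set x in A | (r x < r (f x))%N].
exists B; rewrite mulr2n (bigID (fun x => (r x < r (f x))%N)) /=; congr (_ + _).
  by apply: eq_bigl => x; rewrite inE.
rewrite [RHS](reindex_onto f f) /= => [|x /[!inE]/andP[Ax _]]; last first.
  by case: (fP x Ax).
apply: eq_big => [x|x /andP[/fP[_ _ _ ->]] //].
rewrite inE; apply/andP/andP=> [[Ax] | [/andP[Afx lt_ffx] /eqP ffx]].
  have [Afx ffx /negP nfx _] := fP x Ax; rewrite Afx ffx eqxx.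
  rewrite -leqNgt leq_eqVlt (inj_eq val_inj) (inj_eq enum_rank_inj).
  by case/orP.
have [] := fP _ Afx; rewrite ffx => Ax _ _ _; split=> //.
by rewrite -leqNgt ltnW //; rewrite -{2}ffx.
Qed.

Lemma odd_irr1 (gT : finGroupType) (G : {group gT}) i d :
  odd #|G| -> 'chi[G]_i 1%g = d%:R -> odd d.
Proof.
by move=> oddG Dd; have:= dvd_irr1_cardG i; rewrite Dd dvdC_nat => /dvdn_odd->.
Qed.

(** Orthogonality to the trivial character makes the values of a nontrivial
    [chi] sum to 0. If [chi] is real, the values at [x] and [x^-1] agree, so
    [chi 1] is twice an algebraic integer; but it is an odd integer. *)
Lemma odd_real_irr (gT : finGroupType) (G : {group gT}) i :
  odd #|G| -> conjC_Iirr i = i -> i = 0 :> Iirr G.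
Proof.
move=> oddG real_i; apply/eqP; apply: contraT => nz_i.
have chiV x : 'chi_i x^-1%g = 'chi_i x.
  by rewrite irr_inv -[in RHS]real_i conjC_IirrE cfunE.
have [|B sumB] := @sum_fpf_involution _ _ G^# invg 'chi_i.
  move=> x /setD1P[ntx Gx].
  rewrite !inE invg_eq1 groupV ntx invgK chiV; split=> //.
  apply: contraNneq ntx => xV; apply/eqP/(odd_real_elt oddG Gx).
  by rewrite xV class_refl.
have /eqP: '['chi_i, 'chi_0] = 0 by rewrite cfdot_irr (negPf nz_i).
rewrite irr0 cfdotE mulf_eq0 invr_eq0 (negPf (neq0CG _)) /=.
under eq_bigr => x Gx do rewrite cfun1E Gx rmorph1 mulr1.
rewrite (big_setD1 1%g) ?group1 //= sumB addr_eq0 => /eqP chi1.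
have /natrP[d Dd] := Cnat_irr1 i.
have /negP[] : ~~ (2 %| d)%N by rewrite dvdn2 (odd_irr1 oddG Dd).
rewrite -dvdC_nat; apply/dvdCP; exists (d%:R / 2%:R); last first.
  by rewrite divfK ?pnatr_eq0.
apply: Cint_rat_Aint; first by rewrite rpred_div ?rpred_nat.
rewrite -Dd chi1 -[_ *+ 2]mulr_natr mulNr mulfK ?pnatr_eq0 // rpredN.
by apply: rpred_sum => x _; apply: Aint_irr.
Qed.

(** * Linear characters acting on irreducible characters *)

Section LinearCharacterAction.

Variables (gT : finGroupType) (G : {group gT}).

(** Linear characters form a group only under pointwise product; an abstract
    isomorphic copy lets the theory of group actions apply. *)
Definition lin_group : finGroupType := projT1 (lin_char_group G).
Definition lin_char_of (u : lin_group) : 'CF(G) :=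
  s2val (projT2 (lin_char_group G)) u.

Lemma lin_char_ofP u : lin_char_of u \is a linear_char.
Proof. by rewrite /lin_char_of; case: (s2valP (projT2 (lin_char_group G))). Qed.

Lemma lin_char_of_inj : injective lin_char_of.
Proof. by case: (s2valP (projT2 (lin_char_group G))). Qed.

Lemma card_lin_group : #|[set: lin_group]| = #|G : G^`(1)%g|.
Proof. by rewrite cardsT; case: (s2valP (projT2 (lin_char_group G))). Qed.

Lemma lin_char_of_onto xi :
  xi \is a linear_char -> exists u, xi = lin_char_of u.
Proof. by case: (s2valP (projT2 (lin_char_group G))) => _ _ _; apply. Qed.

Lemma lin_char_of1 : lin_char_of 1%g = 1.
Proof. by case: (s2valP' (projT2 (lin_char_group G))). Qed.

Lemma lin_char_ofM : {morph lin_char_of : u v / (u * v)%g >-> u * v}.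
Proof. by case: (s2valP' (projT2 (lin_char_group G))). Qed.

Lemma lin_char_of_neq0 u x : x \in G -> lin_char_of u x != 0.
Proof. by move=> Gx; rewrite lin_char_neq0 ?lin_char_ofP. Qed.

Lemma lin_char_of_conj u x :
  x \in G -> (lin_char_of u x)^* = lin_char_of u^-1%g x.
Proof.
move=> Gx; apply: (mulfI (lin_char_of_neq0 u Gx)).
rewrite -(lin_charV_conj (lin_char_ofP u)) //.
rewrite -lin_charM ?groupV ?lin_char_ofP // mulgV lin_char1 ?lin_char_ofP //.
have /cfunP/(_ x) := lin_char_ofM u u^-1%g.
by rewrite mulgV lin_char_of1 cfunE cfun1E Gx.
Qed.

Definition lin_mul_Iirr (i : Iirr G) u := cfIirr (lin_char_of u * 'chi_i).

Lemma lin_mul_IirrE i u : 'chi_(lin_mul_Iirr i u) = lin_char_of u * 'chi_i.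
Proof. by rewrite cfIirrE // mul_lin_irr ?lin_char_ofP ?mem_irr. Qed.

Fact lin_mul_Iirr1 : lin_mul_Iirr^~ 1%g =1 id.
Proof.
by move=> i; apply: irr_inj; rewrite lin_mul_IirrE lin_char_of1 mul1r.
Qed.

Fact lin_mul_IirrM i : act_morph lin_mul_Iirr i.
Proof.
by move=> u v; apply: irr_inj; rewrite !lin_mul_IirrE lin_char_ofM mulrCA mulrA.
Qed.

Canonical lin_action := TotalAction lin_mul_Iirr1 lin_mul_IirrM.

Local Notation to := lin_action.
Local Notation lin_orbit i := (orbit to setT i).

Lemma lin_orbit_eq0 i j x :
  j \in lin_orbit i -> ('chi_j x == 0) = ('chi_i x == 0).
Proof.
case/orbitP=> u _ <-; rewrite /= lin_mul_IirrE cfunE mulf_eq0.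
have [Gx | nGx] := boolP (x \in G).
  by rewrite (negPf (lin_char_of_neq0 u Gx)).
by rewrite !cfun0 ?eqxx.
Qed.

Lemma lin_orbit_irr1 i j : j \in lin_orbit i -> 'chi_j 1%g = 'chi_i 1%g.
Proof.
case/orbitP=> u _ <-; rewrite /= lin_mul_IirrE cfunE lin_char1 ?mul1r //.
exact: lin_char_ofP.
Qed.

Lemma lin_orbit_lin i j :
  j \in lin_orbit i -> ('chi_j \is a linear_char) = ('chi_i \is a linear_char).
Proof. by move/lin_orbit_irr1; rewrite !qualifE /= !irr_char => ->. Qed.

Lemma conj_lin_mul i u :
  conjC_Iirr (lin_mul_Iirr i u) = lin_mul_Iirr (conjC_Iirr i) u^-1%g.
Proof.
apply: irr_inj; rewrite conjC_IirrE !lin_mul_IirrE conjC_IirrE.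
apply/cfun_inP=> x Gx.
by rewrite !cfunE rmorphM /= lin_char_of_conj.
Qed.

Lemma conj_lin_orbit i j :
  (conjC_Iirr j \in lin_orbit (conjC_Iirr i)) = (j \in lin_orbit i).
Proof.
apply/orbitP/orbitP=> -[u _ Du]; exists u^-1%g => //.
  by apply: (can_inj conjC_IirrK); rewrite -Du /= conj_lin_mul invgK.
by rewrite -Du /= conj_lin_mul.
Qed.

(** If the conjugate of [chi] were [u * chi], choose [v] with [v * v = u], as
    the group of linear characters has odd order: then [v * chi] is real. *)
Lemma odd_conj_lin_orbit i :
    odd #|G| -> 'chi_i \isn't a linear_char -> conjC_Iirr i \notin lin_orbit i.
Proof.
move=> oddG; apply: contra => /orbitP[u _ /= Du].
have Lu: u \in <[u ^+ 2]>%g.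
  apply: (@odd_mem_sqr _ [set: lin_group]) => //; last exact: cycle_id.
  by rewrite card_lin_group (dvdn_odd (dvdn_indexg _ _)).
have /cycleP[k Dk] := Lu; pose v := (u ^+ k)%g.
have Dv : u = (v * v)%g by rewrite -expgD addnn -mul2n expgM.
have /(odd_real_irr oddG) v0: conjC_Iirr (lin_mul_Iirr i v) = lin_mul_Iirr i v.
  rewrite conj_lin_mul -Du Dv.
  by rewrite -!(actM to) /= mulgK.
have /lin_orbit_lin<-: lin_mul_Iirr i v \in lin_orbit i.
  exact: (mem_orbit to i (in_setT v)).
by rewrite v0 irr0 cfun1_lin_char.
Qed.

(** ** Zeros of characters *)

Definition zero_classes (i : Iirr G) : {set {set gT}} :=
  [set C in classes G | 'chi_i (repr C) == 0].

Definition nzeros i : nat := #|zero_classes i|.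

Lemma card_zero_entries : #|zero_entries G| = (\sum_i nzeros i)%N.
Proof.
pose swap (A B : Type) (p : A * B) := (p.2, p.1).
rewrite /nzeros -sum1_card (reindex_onto (swap _ _) (swap _ _)) /=.
  rewrite (eq_bigl (fun p => true && (p.2 \in zero_classes p.1))) => [|[i C]].
    rewrite -(pair_big_dep xpredT (fun i C => C \in zero_classes i)
      (fun _ _ => 1%N)).
    by apply: eq_bigr => i _; rewrite sum1_card.
  by rewrite !inE eqxx andbT.
by case.
Qed.

Lemma mem_zero_classes i x :
  x \in G -> (x ^: G \in zero_classes i) = ('chi_i x == 0).
Proof.
move=> Gx; rewrite inE mem_classes //=; congr (_ == 0).
by have [y Gy ->] := repr_class G x; rewrite cfunJ.
Qed.

Lemma zero_classes_orbit i j :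
  j \in lin_orbit i -> zero_classes j = zero_classes i.
Proof. by move=> Oij; apply/setP=> C; rewrite !inE (lin_orbit_eq0 _ Oij). Qed.

Lemma zero_classes_conj i : zero_classes (conjC_Iirr i) = zero_classes i.
Proof. by apply/setP=> C; rewrite !inE conjC_IirrE cfunE conjC_eq0. Qed.

Lemma nzeros_orbit i j : j \in lin_orbit i -> nzeros j = nzeros i.
Proof. by move=> Oij; congr #|pred_of_set _|; apply: zero_classes_orbit. Qed.

Lemma nzeros_conj i : nzeros (conjC_Iirr i) = nzeros i.
Proof. by congr #|pred_of_set _|; apply: zero_classes_conj. Qed.

Lemma conj_irr1 i : 'chi_(conjC_Iirr i) 1%g = 'chi[G]_i 1%g.
Proof. by rewrite conjC_IirrE cfunE irr1_degree rmorph_nat. Qed.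

Lemma irr1_gt1 i : ('chi_i \isn't a linear_char) = (1 < 'chi[G]_i 1%g).
Proof.
rewrite qualifE /= irr_char /= irr1_degree pnatr_eq1 ltr1n.
have := irr1_gt0 i; rewrite irr1_degree ltr0n.
by case: (irr_degree _) => [|[|]].
Qed.

(** Burnside's theorem gives a zero [x]; then [x^-1] is a zero too, and it is
    not conjugate to [x]. *)
Lemma nzeros_ge2 i :
  odd #|G| -> 'chi_i \isn't a linear_char -> (2 <= nzeros i)%N.
Proof.
move=> oddG; rewrite irr1_gt1 => /nonlinear_irr_vanish[x Gx chi_x].
have chi_xV : 'chi_i x^-1%g = 0 by rewrite irr_inv chi_x rmorph0.
have neqC : x ^: G != x^-1%g ^: G.
  apply: contra_eq_neq chi_x => Dx; have ->: x = 1%g; last exact: irr1_neq0.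
  by apply: (odd_real_elt oddG Gx); rewrite Dx class_refl.
rewrite -(_ : #|[set x ^: G; x^-1%g ^: G]| = 2)%N; last by rewrite cards2 neqC.
apply: subset_leq_card; apply/subsetP=> _ /set2P[]->.
  by rewrite mem_zero_classes ?chi_x.
by rewrite mem_zero_classes ?groupV ?chi_xV.
Qed.

Lemma lin_stab_vanish i u x :
    x \in G -> u \in 'C[i | to] -> lin_char_of u x != 1 -> 'chi_i x = 0.
Proof.
move=> Gx /astab1P/(congr1 (fun j => 'chi_j x)) /=.
rewrite lin_mul_IirrE cfunE => Du ux_neq1; apply/eqP.
have: (lin_char_of u x - 1) * 'chi_i x = 0 by rewrite mulrBl Du mul1r subrr.
by move/eqP; rewrite mulf_eq0 subr_eq0 (negPf ux_neq1).
Qed.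

Lemma card_lin_orbit_stab i :
  (#|lin_orbit i| * #|('C[i | to])%g| = #|G : G^`(1)%g|)%N.
Proof.
by rewrite -card_lin_group -(card_orbit_stab to [group of setT] i) setTI.
Qed.

(** These linear characters are irreducible characters of the abelian group
    [G / J]. *)
Lemma card_lin_subgroup (A : {set lin_group}) (J : {group gT}) :
    G^`(1)%g \subset J -> J \subset G ->
    {in A, forall u, J \subset cfker (lin_char_of u)} ->
  (#|A| <= #|G : J|)%N.
Proof.
move=> sG'J sJG kerA; have nsJG := sub_der1_normal sG'J sJG.
pose f u := quo_Iirr J (lin_mul_Iirr 0 u).
have fE u : 'chi_(lin_mul_Iirr 0 u) = lin_char_of u.
  by rewrite lin_mul_IirrE irr0 mulr1.
have inj_f : {in A &, injective f}.
  move=> u v Au Av /(congr1 (fun k => 'chi_(mod_Iirr k))).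
  by rewrite !quo_IirrK ?fE ?kerA // => /lin_char_of_inj.
rewrite -(card_in_imset inj_f) (leq_trans (max_card _)) // card_Iirr_abelian.
  by rewrite card_quotient ?normal_norm.
by rewrite sub_der1_abelian.
Qed.

(** Let [J] be the common kernel of the linear characters that fix [chi]. Then
    [chi] vanishes off [J], and each coset of the derived subgroup outside [J]
    contains a class. The index of [J] is at least the order [s] of the
    stabiliser, so at most [#|G : G^`(1)| / s] cosets lie inside [J], which is
    the length of the orbit of [chi]. *)
Lemma nzeros_lin_orbit i :
  (#|G : G^`(1)%g| <= nzeros i + #|lin_orbit i|)%N.
Proof.
set G' := G^`(1)%G; set S := ('C[i | to])%g.
pose J : {group gT} := (G :&: \bigcap_(u in S) cfker (lin_char_of u))%G.
have sJG : J \subset G by apply: subsetIl.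
have sG'J : G' \subset J.
  rewrite subsetI der_sub; apply/bigcapsP=> u _.
  exact/lin_char_der1/lin_char_ofP.
have nsG'G : G' <| G := der_normal 1 G.
have nG'G := normal_norm nsG'G.
have leS : (#|S| <= #|G : J|)%N.
  apply: card_lin_subgroup => // u Su.
  by rewrite subIset //; apply/orP; right; apply: bigcap_inf.
have leJ : (#|J : G'| <= #|lin_orbit i|)%N.
  rewrite -(leq_pmul2r (cardG_gt0 S)) card_lin_orbit_stab.
  by rewrite -(Lagrange_index sJG sG'J) mulnC leq_mul2r leS orbT.
have GJvanish x : x \in G :\: J -> 'chi_i x = 0.
  case/setDP=> Gx; rewrite inE Gx /= => /bigcapP nJx.
  have [//|nz_x] := eqVneq ('chi_i x) 0; case: nJx => u Su.
  rewrite cfkerEchar ?lin_charW ?lin_char_ofP // inE Gx /=.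
  rewrite lin_char1 ?lin_char_ofP //.
  by apply: contraNT nz_x => ntu; rewrite (lin_stab_vanish Gx Su ntu).
rewrite addnC -(card_quotient nG'G) -leq_subLR.
apply: leq_trans (leq_sub2l _ leJ) _.
rewrite -card_quotient ?(subset_trans sJG) // -cardsDS ?quotientS //.
apply: leq_trans (leq_imset_card (fun C => coset G' (repr C)) _).
apply/subset_leq_card/subsetP=> _ /setDP[/morphimP[x Nx Gx ->] nJx].
have{} nJx : x \notin J by apply: contra nJx; apply: mem_quotient.
apply/imsetP; exists (x ^: G).
  by rewrite mem_zero_classes // GJvanish // inE nJx.
have [y Gy ->] := repr_class G x; have Ny := subsetP nG'G y Gy.
rewrite morphJ //; apply/esym/conjg_fixP/commgP.
by apply: (centsP (der_abelian 0 G)); apply: mem_quotient.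
Qed.

(** ** Restriction to the derived subgroup *)

Lemma lin_char_of_separates x :
  x \in G -> x \notin G^`(1)%g -> exists u, lin_char_of u x != 1.
Proof.
move=> Gx nG'x; apply/existsP; apply: contraR nG'x => /existsPn lin1.
rewrite -cap_cfker_lin_irr; apply/bigcapP=> i Li.
have [u Du] := lin_char_of_onto Li.
rewrite cfkerEchar ?irr_char // inE Gx Du lin_char1 ?lin_char_ofP //.
by have:= lin1 u; rewrite negbK.
Qed.

Lemma sum_lin_char_of x : x \in G ->
  \sum_u lin_char_of u x = #|G : G^`(1)%g|%:R *+ (x \in G^`(1)%g).
Proof.
move=> Gx; have [G'x | nG'x] := boolP (x \in _).
  rewrite -card_lin_group -sum1_card natr_sum; apply: eq_big => [u | u _].
    by rewrite inE.
  rewrite cfker1 ?lin_char1 ?lin_char_ofP //.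
  exact: subsetP (lin_char_der1 (lin_char_ofP u)) x G'x.
have [u ntu] := lin_char_of_separates Gx nG'x.
rewrite (mulr0n (_ : algC)) //; apply/eqP.
have: (lin_char_of u x - 1) * (\sum_v lin_char_of v x) = 0.
  rewrite mulrBl mul1r mulr_sumr [X in _ - X](reindex_inj (mulgI u)) /=.
  apply/eqP; rewrite subr_eq0; apply/eqP/eq_bigr => v _.
  by rewrite lin_char_ofM cfunE.
by move/eqP; rewrite mulf_eq0 subr_eq0 (negPf ntu).
Qed.

(** Both sides are the sum over all linear characters [u] of the inner product
    of [u * chi] and [chi], since the [u] add up to a multiple of the
    indicator of the derived subgroup. *)
Lemma cfnorm_Res_der1 i :
  '['Res[G^`(1)%g] 'chi_i] = #|('C[i | to])%g|%:R.
Proof.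
have sG'G : G^`(1)%g \subset G := der_sub 1 G.
transitivity (\sum_u '['chi_(lin_mul_Iirr i u), 'chi_i]); last first.
  rewrite -sum1_card natr_sum [RHS]big_mkcond; apply: eq_bigr => u _.
  by rewrite cfdot_irr (sameP astab1P eqP) /=; case: eqP.
under [RHS]eq_bigr => u _ do rewrite cfdotE lin_mul_IirrE.
rewrite -mulr_sumr exchange_big /= cfdotE -(Lagrange sG'G) natrM invfM -mulrA.
congr (_ * _); rewrite mulr_sumr [RHS](big_setID G^`(1)%g) /=.
have sumE x : \sum_u (lin_char_of u * 'chi_i) x * ('chi_i x)^*
            = (\sum_u lin_char_of u x) * ('chi_i x * ('chi_i x)^*).
  by rewrite mulr_suml; apply: eq_bigr => u _; rewrite cfunE mulrA.
rewrite [X in _ = _ + X]big1 ?addr0 => [|x /setDP[Gx nG'x]]; last first.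
  by rewrite sumE sum_lin_char_of // (negPf nG'x) mulr0n mul0r mulr0.
rewrite (setIidPr sG'G); apply: eq_bigr => x G'x; rewrite !cfResE // sumE.
rewrite sum_lin_char_of ?(subsetP sG'G) // G'x mulr1n mulKf //.
by rewrite pnatr_eq0 -lt0n.
Qed.

(** A regular orbit has trivial stabilisers, so [chi] restricts irreducibly to
    the derived subgroup. *)
Lemma lin_orbit_regular_dvd i d :
  #|lin_orbit i| = #|G : G^`(1)%g| -> 'chi_i 1%g = d%:R -> (d %| #|G^`(1)%g|)%N.
Proof.
move=> oi Dd; have := card_lin_orbit_stab i; rewrite oi -{2}[#|_ : _|]muln1.
move/eqP; rewrite eqn_pmul2l // => /eqP st1.
have /irrP[j Dj]: 'Res[G^`(1)%G] 'chi_i \in irr G^`(1)%G.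
  by rewrite irrEchar cfRes_char ?irr_char //= cfnorm_Res_der1 st1.
by have := dvd_irr1_cardG j; rewrite -Dj cfRes1 Dd dvdC_nat.
Qed.

(** ** Consequences of few zeros *)

Definition nonlinear : {set Iirr G} := [set i | 'chi_i \isn't a linear_char].

Local Notation l := #|G : G^`(1)%g|.
(** The hypothesis of few zeros bounds the sum of [11 * nzeros i - 16] over the
    nonlinear characters by a number that involves the linear ones alone. *)
Local Notation weight i := (11 * nzeros i - 16)%N.

Lemma card_Iirr_nonlinear : #|Iirr G| = (l + #|nonlinear|)%N.
Proof.
rewrite -card_lin_irr -(cardC [pred i | 'chi[G]_i \is a linear_char]).
by congr (_ + _)%N; apply: eq_card => i; rewrite !inE.
Qed.

Lemma nonlinear_orbit i : i \in nonlinear -> lin_orbit i \subset nonlinear.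
Proof.
by rewrite inE => NLi; apply/subsetP=> j /lin_orbit_lin; rewrite inE => ->.
Qed.

Lemma nonlinear_conj i : (conjC_Iirr i \in nonlinear) = (i \in nonlinear).
Proof. by rewrite !inE !irr1_gt1 conj_irr1. Qed.

Lemma nonlinear_conj_neq i :
  odd #|G| -> i \in nonlinear -> i != conjC_Iirr i.
Proof.
move=> oddG; apply: contraTneq => /esym/(odd_real_irr oddG)->.
by rewrite inE irr0 cfun1_lin_char.
Qed.

Lemma card_nonlinear_degree d :
  {in nonlinear, forall i, 'chi_i 1%g = d%:R} ->
  #|G| = (l + #|nonlinear| * d ^ 2)%N.
Proof.
move=> degNL; apply/eqP; rewrite -eqC_nat -irr_sum_square.
rewrite (bigID (mem nonlinear)) /= addrC natrD; apply/eqP; congr (_ + _).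
  rewrite -card_lin_irr -sum1_card natr_sum.
  apply: eq_big => i; rewrite !inE negbK //.
  by move=> Li; rewrite lin_char1 ?expr1n.
rewrite natrM mulr_natl -sumr_const; apply: eq_bigr => i /degNL->.
by rewrite -natrX.
Qed.

Lemma card_der1_nonlinear d m :
  {in nonlinear, forall i, 'chi_i 1%g = d%:R} -> #|nonlinear| = (m * l)%N ->
  #|G^`(1)%g| = (1 + m * d ^ 2)%N.
Proof.
move=> degNL cardNL; apply/eqP.
rewrite -(eqn_pmul2r (indexg_gt0 G G^`(1)%g)) Lagrange ?der_sub //.
by rewrite (card_nonlinear_degree degNL) cardNL; apply/eqP; lia.
Qed.

Section FewZeros.

Hypotheses (oddG : odd #|G|).
Hypothesis few_zeros : (11 * #|zero_entries G| < 16 * #|Iirr G|)%N.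

Lemma sum_weight : (\sum_(i in nonlinear) weight i < 16 * l)%N.
Proof.
rewrite -(ltn_add2r (16 * #|nonlinear|)) -mulnDr -card_Iirr_nonlinear.
apply: leq_ltn_trans few_zeros.
rewrite mulnC -sum_nat_const -big_split /= card_zero_entries big_distrr /=.
rewrite [X in (_ <= X)%N](bigID (mem nonlinear)) /=.
apply: leq_trans (leq_addr _ _).
apply: leq_sum => i; rewrite inE => NLi; rewrite subnK //.
by have := nzeros_ge2 oddG NLi; lia.
Qed.

Lemma weight_bound (A B : {set Iirr G}) a b :
    A \subset nonlinear -> B \subset nonlinear -> [disjoint A & B] ->
    {in A, forall i, a <= weight i}%N -> {in B, forall i, b <= weight i}%N ->
  (#|A| * a + #|B| * b < 16 * l)%N.
Proof.
move=> sA sB dAB wA wB; apply: leq_ltn_trans sum_weight.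
have sBA : B \subset nonlinear :\: A by rewrite subsetD sB disjoint_sym.
rewrite (big_setID A) /= (setIidPr sA).
rewrite [X in (_ <= _ + X)%N](big_setID B) /= (setIidPr sBA).
rewrite -!sum_nat_const addnA; apply: leq_trans (leq_addr _ _).
by apply: leq_add; apply: leq_sum.
Qed.

Lemma weight_bound1 (A : {set Iirr G}) a :
    A \subset nonlinear -> {in A, forall i, a <= weight i}%N ->
  (#|A| * a < 16 * l)%N.
Proof.
move=> sA wA; apply: leq_ltn_trans sum_weight.
rewrite (big_setID A) /= (setIidPr sA) -sum_nat_const.
by apply: leq_trans (leq_addr _ _); apply: leq_sum.
Qed.

Lemma weight_ge6 : {in nonlinear, forall i, 6 <= weight i}%N.
Proof. by move=> i; rewrite inE => /(nzeros_ge2 oddG); lia. Qed.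

Lemma weight_orbit i j : j \in lin_orbit i ->
  (11 * (l - #|lin_orbit i|) - 16 <= weight j)%N.
Proof. by move/nzeros_orbit->; have := nzeros_lin_orbit i; lia. Qed.

Lemma odd_lin_index : odd l.
Proof. by rewrite (dvdn_odd (dvdn_indexg _ _)). Qed.

(** The orbits of [chi] and of its conjugate are disjoint and both regular;
    their weight leaves no room for another nonlinear character. So all
    nonlinear characters have the same degree [d], and
    [#|G^`(1)| = 1 + 2 * d ^ 2]. As [d] divides this order, [d = 1]. *)
Lemma no_regular_orbit i : i \in nonlinear -> #|lin_orbit i| <> l.
Proof.
move=> NLi Oi.
have NLi' : conjC_Iirr i \in nonlinear by rewrite nonlinear_conj.
have Oi' : #|lin_orbit (conjC_Iirr i)| = l.
  rewrite -Oi -[RHS](card_imset _ (can_inj conjC_IirrK)).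
  congr #|pred_of_set _|; apply/setP=> j.
  apply/idP/imsetP=> [Oj | [k Ok ->]]; last by rewrite conj_lin_orbit.
  exists (conjC_Iirr j); last by rewrite conjC_IirrK.
  by rewrite -(conj_lin_orbit i) conjC_IirrK.
have dOO' : [disjoint lin_orbit i & lin_orbit (conjC_Iirr i)].
  rewrite -setI_eq0.
  apply: contraTT (NLi) => /set0Pn[j /setIP[/orbit_eqP Oij Oi'j]].
  rewrite inE negbK; apply: contraLR Oi'j => NL.
  apply: contra (odd_conj_lin_orbit oddG NL) => /orbit_eqP Oi'j.
  by rewrite -Oij Oi'j orbit_refl.
pose U := lin_orbit i :|: lin_orbit (conjC_Iirr i).
have sOO' : U \subset nonlinear.
  by rewrite subUset !nonlinear_orbit.
have cOO' : #|U| = (2 * l)%N.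
  by rewrite cardsU (disjoint_setI0 dOO') cards0 Oi Oi'; lia.
have O_conj j : (conjC_Iirr j \in U) = (j \in U).
  by rewrite !in_setU -(conj_lin_orbit i) conjC_IirrK conj_lin_orbit orbC.
have w6 : {in U, forall i, 6 <= weight i}%N.
  by move=> j /(subsetP sOO')/weight_ge6.
have l_odd := odd_lin_index.
have sNL : nonlinear \subset U.
  apply/subsetP=> j NLj; apply: contraT => nOj.
  have dQ : [disjoint U & lin_orbit j].
    rewrite -setI_eq0.
    apply: contraR nOj => /set0Pn[k /setIP[/setUP[] Ok /orbit_eqP Qk]].
      by rewrite in_setU -(orbit_eqP Ok) Qk orbit_refl.
    by rewrite in_setU -(orbit_eqP Ok) Qk orbit_refl orbT.
  have w6Q : {in lin_orbit j, forall i, 6 <= weight i}%N.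
    by move=> k /(subsetP (nonlinear_orbit NLj))/weight_ge6.
  (* The orbit of [j] bounds its own length [t] by [2 * l / 3], hence by
     [l / 3]; then [j] and its conjugate alone are too heavy. *)
  have := weight_bound sOO' (nonlinear_orbit NLj) dQ w6 w6Q.
  have dQ2 : [disjoint U & [set j; conjC_Iirr j]].
    rewrite disjoint_sym disjoints_subset subUset !sub1set !in_setC.
    by rewrite O_conj nOj.
  have sA2 : [set j; conjC_Iirr j] \subset nonlinear.
    by rewrite subUset !sub1set nonlinear_conj NLj.
  have wA2 : {in [set j; conjC_Iirr j], forall k,
      11 * (l - #|lin_orbit j|) - 16 <= weight k}%N.
    by move=> _ /set2P[]->; rewrite ?nzeros_conj weight_orbit ?orbit_refl.
  have := weight_bound sOO' sA2 dQ2 w6 wA2.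
  have := card_lin_orbit_stab j; rewrite cOO' cards2.
  rewrite nonlinear_conj_neq //.
  move: #|lin_orbit j| #|('C[j | to])%g| l_odd => t s.
  move: l => L L_odd ts; rewrite -{}ts in L_odd *.
  move: L_odd; rewrite oddM => /andP[]; case: s => [|[|[|s]]] //.
    by rewrite muln1; clear; lia.
  case: t => // t _ _.
  have : (3 * t.+1 <= t.+1 * s.+3)%N by rewrite mulnC leq_mul2l.
  by move: (t.+1 * s.+3)%N => m; clear; lia.
have /natrP[d Dd] := Cnat_irr1 i.
have := lin_orbit_regular_dvd Oi Dd.
have defNL : nonlinear = U.
  by apply/eqP; rewrite eqEsubset sNL.
have degNL : {in nonlinear, forall j, 'chi_j 1%g = d%:R}.
  by move=> j; rewrite defNL => /setUP[]/lin_orbit_irr1->; rewrite ?conj_irr1.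
have cardNL : #|nonlinear| = (2 * l)%N by rewrite defNL.
(* The common degree [d] divides [1 + 2 * d ^ 2]. *)
rewrite (card_der1_nonlinear degNL cardNL).
rewrite dvdn_addl ?dvdn_mull ?dvdn_exp // dvdn1 => /eqP d1.
by move: NLi; rewrite inE irr1_gt1 Dd d1 ltxx.
Qed.

(** Let the orbit have length [t] and the stabiliser order [s], both odd. If
    [t, s >= 3], the orbit has weight at least [t * (11 * t * (s - 1) - 16)],
    which exceeds [16 * l = 16 * t * s]. *)
Lemma lin_orbit_trivial i : i \in nonlinear -> #|lin_orbit i| = 1%N.
Proof.
move=> NLi; have NOi := no_regular_orbit NLi.
have := weight_bound1 (nonlinear_orbit NLi) (@weight_orbit i).
have := card_lin_orbit_stab i; move: NOi odd_lin_index.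
move: #|lin_orbit i| #|('C[i | to])%g| => t s.
move: l => L NtL L_odd Dts; rewrite -{}Dts in L_odd NtL *.
move: L_odd; rewrite oddM => /andP[].
case: s NtL => [|[|[|s]]] //; first by rewrite muln1.
case: t => [|[|[|t]]] // _ _ _.
rewrite [X in (_ < X)%N]mulnCA ltn_pmul2l // mulnS addKn.
have : (3 * s.+2 <= t.+3 * s.+2)%N by rewrite leq_mul2r.
by move: (t.+3 * s.+2)%N => m; clear; lia.
Qed.

(** Trivial orbits make each of the [n] nonlinear characters vanish on [l - 1]
    classes, so [n * (11 * (l - 1) - 16) < 16 * l]; and [n >= 2] because of
    complex conjugation. *)
Lemma few_nonlinear : ~~ abelian G ->
  [\/ l = 3%N /\ (#|nonlinear| <= 7)%N, l = 5%N /\ #|nonlinear| = 2%N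
    | l = 7%N /\ #|nonlinear| = 2%N].
Proof.
move=> nabG; have [i NLi] : exists i, i \in nonlinear.
  apply/existsP; apply: contraR nabG => /existsPn noNL.
  by apply/char_abelianP=> i; have := noNL i; rewrite inE negbK.
have gt1 : (1 < #|nonlinear|)%N.
  apply: leq_trans (_ : #|[set i; conjC_Iirr i]| <= _)%N.
    by rewrite cards2 nonlinear_conj_neq.
  by apply: subset_leq_card; rewrite subUset !sub1set nonlinear_conj NLi.
have wNL : {in nonlinear, forall j, 11 * (l - 1) - 16 <= weight j}%N.
  move=> j NLj; have := weight_orbit (orbit_refl to setT j).
  by rewrite lin_orbit_trivial.
have := weight_bound1 (subxx _) wNL.
have := no_regular_orbit NLi; rewrite lin_orbit_trivial // => /eqP.
move: odd_lin_index gt1; move: l #|nonlinear| => L n.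
clear; move=> L_odd n_gt1 L_neq1 small.
have small2 : (2 * (11 * (L - 1) - 16) < 16 * L)%N.
  by apply: leq_ltn_trans (small); rewrite leq_mul2r n_gt1 orbT.
have : (L < 9)%N by lia.
move: L_odd L_neq1 n_gt1 small; clear.
case: L => [|[|[|[|[|[|[|[|[|]]]]]]]]] //= _ _ n1 h _.
- by constructor 1; split=> //; lia.
- by constructor 2; split=> //; lia.
- by constructor 3; split=> //; lia.
Qed.

End FewZeros.

Lemma lin_orbit_trivial_vanish i x :
  #|lin_orbit i| = 1%N -> x \in G :\: G^`(1)%g -> 'chi_i x = 0.
Proof.
move=> O1 /setDP[Gx nG'x]; have [u ntu] := lin_char_of_separates Gx nG'x.
apply: (@lin_stab_vanish i u x) => //; apply/astab1P.
have /cards1P[j Oj] : #|lin_orbit i| == 1%N by apply/eqP.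
have /set1P-> : to i u \in [set j] by rewrite -Oj mem_orbit ?inE.
by apply/esym/set1P; rewrite -Oj orbit_refl.
Qed.

(** By column orthogonality, the nonzero contributions to the order of the
    centraliser come from the linear characters, and each is 1. *)
Lemma card_cent1_vanish x :
    x \in G -> {in nonlinear, forall i, 'chi_i x = 0} ->
  #|'C_G[x]| = l.
Proof.
move=> Gx NLx; apply/eqP; rewrite -eqC_nat.
have := second_orthogonality_relation x Gx; rewrite class_refl mulr1n => <-.
rewrite (bigID (mem nonlinear)) /= big1 => [|i /NLx->]; last by rewrite mul0r.
rewrite add0r -card_lin_irr -sum1_card natr_sum.
apply/eqP/eq_big => i; rewrite !inE negbK //.
by move=> Li; rewrite -normCK normC_lin_char ?expr1n.
Qed.

End LinearCharacterAction.

(** * Groups with all centralisers of prime order outside a normal subgroup *)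

(** An [x] outside [N] has prime order and generates its own centraliser, which
    therefore meets [N] trivially. *)
Lemma prime_cent1_Frobenius (gT : finGroupType) (G N : {group gT}) :
    N <| G -> N :!=: 1%g -> prime #|G : N| ->
    {in G :\: N, forall x, #|'C_G[x]| = #|G : N|} ->
  exists2 x, x \in G :\: N & [Frobenius G = N ><| <[x]>].
Proof.
move=> nsNG ntN q_pr cardC; set q := #|G : N| in q_pr cardC.
have [sNG nNG] := andP nsNG.
have /subsetPn[x Gx nNx] : ~~ (G \subset N) by rewrite -indexg_gt1 prime_gt1.
have GNx : x \in G :\: N by rewrite inE nNx.
have TI_C y : y \in G :\: N -> N :&: 'C_G[y] = 1%g.
  move=> GNy; rewrite setIC prime_TIg ?cardC //.
  have [Gy nNy] := setDP GNy; apply: contra nNy => /subsetP; apply.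
  by rewrite in_setI Gy cent1id.
have sxC y : y \in G -> <[y]> \subset 'C_G[y].
  by move=> Gy; rewrite subsetI !cycle_subG Gy cent1id.
have ox : #[x] = q.
  apply/(prime_nt_dvdP q_pr); last by rewrite -(cardC x) // orderE cardSg ?sxC.
  by rewrite order_eq1; apply: contraNneq nNx => ->.
have TI_x : N :&: <[x]> = 1%g.
  by apply/trivgP; rewrite -(TI_C x GNx) setIS ?sxC.
have defG : N ><| <[x]> = G.
  rewrite sdprodE ?cycle_subG ?(subsetP nNG) //; apply/eqP.
  by rewrite eqEcard mul_subG ?cycle_subG //= TI_cardMg // -orderE ox Lagrange.
exists x => //; apply/Frobenius_semiregularP => //.
  by rewrite -cardG_gt1 -orderE ox prime_gt1.
move=> y /setD1P[nty xy]; apply/trivgP.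
have Gy : y \in G by apply: subsetP xy; rewrite cycle_subG.
rewrite -(TI_C y) ?setIA ?(setIidPl sNG) // inE Gy andbT.
apply: contra nty => Ny; apply/eqP/set1P.
by rewrite -[[set 1%g]]TI_x inE Ny.
Qed.

Section CubesOutsideNormal.

Variables (gT : finGroupType) (G N : {group gT}).
Hypotheses (nsNG : N <| G) (prNG : ~~ (G \subset N)).
Hypothesis cube1 : {in G :\: N, forall g, (g ^+ 3 = 1)%g}.

(** This is the cube of [g * x], since [g ^+ 3 = 1]. *)
Lemma cube_conj_prod x g : x \in N -> g \in G :\: N ->
  (x ^ (g ^+ 2) * x ^ g * x = 1)%g.
Proof.
move=> Nx GNg; have := cube1 GNg; have [Gg nNg] := setDP GNg.
have : ((g * x) ^+ 3 = 1)%g.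
  apply: cube1; rewrite inE groupMr // nNg groupM //.
  exact: subsetP (normal_sub nsNG) x Nx.
have -> : ((g * x) ^+ 3 = g ^+ 3 * (x ^ (g ^+ 2) * x ^ g * x))%g.
  by rewrite !expgS !expg0 !mulg1 !conjgE !invMg !mulgA !mulgK.
by move=> + g3; rewrite g3 mul1g.
Qed.

(** Apply the product formula to [g] and to [g^-1]: the two conjugates of [x]
    commute, and their product is [x^-1]. *)
Lemma cube_comm_conj x g : x \in N -> g \in G :\: N -> commute x (x ^ g)%g.
Proof.
move=> Nx GNg; have g3 := cube1 GNg.
have GNg' : (g^-1)%g \in G :\: N by rewrite in_setD !groupV -in_setD.
have Dg2 : (g ^+ 2 = g^-1)%g by apply: (mulIg g); rewrite -expgSr g3 mulVg.
have := cube_conj_prod Nx GNg; have := cube_conj_prod Nx GNg'.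
rewrite expgVn Dg2 invgK => E1 E2.
have cgg : commute (x ^ g)%g (x ^ g^-1)%g by apply: (mulIg x); rewrite E1 E2.
have Dx : x = ((x ^ g * x ^ g^-1)^-1)%g.
  by apply: (mulgI (x ^ g * x ^ g^-1)%g); rewrite E1 mulgV.
by apply/commute_sym; rewrite {2}Dx; apply/commuteV/commuteM.
Qed.

(** Write [x] as the inverse of a product of conjugates of [x] by elements
    outside [N]. Conjugated by [y], these are still conjugates of [x] by
    elements outside [N], hence commute with [x]. *)
Lemma cube_comm_conj_ker x y : x \in N -> y \in N -> commute x (x ^ y)%g.
Proof.
move=> Nx Ny; have /subsetPn[g Gg nNg] := prNG.
have GNg : g \in G :\: N by rewrite inE nNg.
have Gy : y \in G := subsetP (normal_sub nsNG) y Ny.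
have g3 := cube1 GNg.
have GNg' : (g^-1)%g \in G :\: N by rewrite in_setD !groupV -in_setD.
have Dg2 : (g ^+ 2 = g^-1)%g by apply: (mulIg g); rewrite -expgSr g3 mulVg.
have comm_gy h : h \in G :\: N -> commute x ((x ^ h) ^ y)%g.
  case/setDP=> Gh nNh; rewrite -conjgM; apply: cube_comm_conj => //.
  by rewrite inE groupMr // nNh groupM.
have := cube_conj_prod Nx GNg; rewrite Dg2 => E1.
have Dx : x = ((x ^ g^-1 * x ^ g)^-1)%g.
  by apply: (mulgI (x ^ g^-1 * x ^ g)%g); rewrite E1 mulgV.
rewrite {2}Dx conjVg conjMg; apply: commuteV; apply: commuteM; exact: comm_gy.
Qed.

(** The conjugates of [x] generate an abelian normal subgroup, so [x] lies in
    the Fitting subgroup. *)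
Lemma cube_nilpotent : nilpotent N.
Proof.
suff sNF : N \subset 'F(N) by apply: nilpotentS sNF (Fitting_nil N).
apply/subsetP=> x Nx.
have sxN : x ^: N \subset N by rewrite class_sub_norm ?normG.
have abA : abelian <<x ^: N>>.
  rewrite abelian_gen; apply/centsP=> _ /imsetP[a Na ->] _ /imsetP[b Nb ->].
  apply: (can_inj (conjgK a^-1%g)).
  rewrite [LHS]conjMg [RHS]conjMg -!conjgM mulgV conjg1.
  by apply: cube_comm_conj_ker; rewrite ?groupM ?groupV.
have nsA : <<x ^: N>> <| N.
  by rewrite /normal gen_subG sxN norms_gen ?class_norm.
apply: subsetP (Fitting_max nsA (abelian_nil abA)) _ _.
exact: mem_gen (class_refl N x).
Qed.

End CubesOutsideNormal.

(** * The order of the derived subgroup *)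

(** A constituent of the restriction to [A] is linear, and [chi] is a
    constituent of the character that it induces. *)
Lemma irr1_le_index_abelian (gT : finGroupType) (G A : {group gT}) i :
  A \subset G -> abelian A -> 'chi[G]_i 1%g <= #|G : A|%:R.
Proof.
move=> sAG abA.
have [j /=] : exists j, j \in irr_constt ('Res[A] 'chi_i).
  apply: neq0_has_constt; apply: contraNneq (irr1_neq0 i) => res0.
  by rewrite -(cfRes1 A) res0 cfunE.
rewrite -constt_Ind_Res => /(char1_ge_constt (cfInd_char G (irr_char j))).
have /char_abelianP linA := abA.
by rewrite cfInd1 // (lin_char1 (linA j)) mulr1.
Qed.

(** The nonlinear characters have odd degree at most 3. *)
Lemma card_metabelian_index3 (gT : finGroupType) (G : {group gT}) :
    odd #|G| -> #|G : G^`(1)%g| = 3%N -> abelian G^`(1)%g ->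
  #|G^`(1)%g| = (1 + 3 * #|nonlinear G|)%N.
Proof.
move=> oddG lG abG'; have deg3 : {in nonlinear G, forall i, 'chi_i 1%g = 3%:R}.
  move=> i; rewrite inE irr1_gt1.
  have := irr1_le_index_abelian i (der_sub 1 G) abG'; rewrite lG.
  have /natrP[d Dd] := Cnat_irr1 i; have := odd_irr1 oddG Dd.
  by rewrite Dd ler_nat ltr1n; case: d {Dd} => [|[|[|[|d]]]].
apply/eqP; rewrite -(eqn_pmul2r (indexg_gt0 G G^`(1)%g)) Lagrange ?der_sub //.
by rewrite (card_nonlinear_degree deg3) lG; apply/eqP; lia.
Qed.

Lemma card_Iirr_quo (gT : finGroupType) (G H : {group gT}) :
  H <| G -> (#|Iirr (G / H)| <= #|Iirr G|)%N.
Proof. by move=> nsHG; apply: (leq_card _ (can_inj (mod_IirrK nsHG))). Qed.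

(** Let [N] be the derived subgroup. Its abelianisation has order [1 + 3 * m],
    where [m <= 7] counts nonlinear characters of a quotient of [G]; parity
    makes [m] even. So the abelianisation is trivial or of prime order, and a
    nilpotent [N] is then cyclic. *)
Lemma index3_der1 (gT : finGroupType) (G : {group gT}) :
    odd #|G| -> #|G : G^`(1)%g| = 3%N -> (#|nonlinear G| <= 7)%N ->
    nilpotent G^`(1)%g -> ~~ abelian G ->
  #|G^`(1)%g| \in [:: 7; 13; 19]%N.
Proof.
move=> oddG lG leNL nilN nabG; pose N := G^`(1)%G; pose M := N^`(1)%G.
have nsMG : M <| G := der_normal 2 G.
have sMN : M \subset N := der_sub 1 N.
pose Q := (G / M)%G.
have Q' : Q^`(1)%g = (N / M)%g by rewrite -quotient_der ?normal_norm.
have lQ : #|Q : Q^`(1)%g| = 3%N.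
  rewrite Q' index_quotient_eq ?(normal_norm nsMG) ?der_sub //.
  exact: subset_trans (subsetIr _ _) sMN.
have oddQ : odd #|Q| := dvdn_odd (dvdn_quotient _ _) oddG.
have abQ' : abelian Q^`(1)%g by rewrite Q' der_abelian.
have cQ' := card_metabelian_index3 oddQ lQ abQ'.
have leQ : (#|nonlinear Q| <= 7)%N.
  have := card_Iirr_quo nsMG; rewrite !card_Iirr_nonlinear lQ lG leq_add2l.
  by move/leq_trans; apply.
have oddQ' : odd #|Q^`(1)%g| by rewrite (dvdn_odd (cardSg (der_sub 1 Q))).
have cQ'_in : #|Q^`(1)%g| \in [:: 1; 7; 13; 19]%N.
  move: oddQ' leQ; rewrite cQ'; move: #|nonlinear Q|.
  by do 8?case=> //.
have cycQ' : cyclic (N / N^`(1)).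
  move: cQ'_in; rewrite Q' inE => /predU1P[/card1_trivg-> | ].
    exact: cyclic1.
  by rewrite !inE => /or3P[]/eqP c; apply: prime_cyclic; rewrite c.
have cycN := cyclic_nilpotent_quo_der1_cyclic nilN cycQ'.
have M1 : M :=: 1%g by apply/derG1P/cyclic_abelian.
have cN : #|N| = #|Q^`(1)%g| by rewrite Q' M1 card_quotient ?norms1 // indexg1.
move: cQ'_in; rewrite -cN inE => /predU1P[/card1_trivg N1 | ] //.
by case/negP: nabG; apply/derG1P.
Qed.

(** The Sylow 3-subgroup of [N] is unique, hence normal in [G], and [G] cannot
    invert its generators. *)
Lemma odd_normal_order15_cent (gT : finGroupType) (G N : {group gT}) :
  odd #|G| -> N <| G -> #|N| = 15%N -> exists2 x, x \in N^# & x \in 'C(G).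
Proof.
move=> oddG nsNG cN; have [sNG nNG] := andP nsNG.
have [P sylP] := Sylow_exists 3 N; have [sPN _ _] := and3P sylP.
have cP : #|P| = 3%N by rewrite (card_Hall sylP) cN p_part.
have syl1 : #|'Syl_3(N)| = 1%N.
  have := card_Syl_dvd 3 N; rewrite cN => syl_dvd.
  move: (@dvdn_leq _ 15 isT syl_dvd) (syl_dvd) (card_Syl_mod N (isT : prime 3)).
  by move: #|'Syl_3(N)|; do 16?case=> //.
have nPG : G \subset 'N(P).
  apply/subsetP=> g Gg; rewrite inE.
  have sylPg : 3.-Sylow(N) (P :^ g) by rewrite pHallJnorm ?(subsetP nNG).
  move/eqP/cards1P: syl1 => [P0 Syl1].
  have /set1P DPg : (P :^ g)%G \in [set P0] by rewrite -Syl1 inE.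
  have /set1P DP : P \in [set P0] by rewrite -Syl1 inE.
  by have /= -> := congr1 (@gval _) (etrans DPg (esym DP)).
have [x Px ntx] : exists2 x, x \in P & x != 1%g.
  by apply/trivgPn; rewrite -cardG_gt1 cP.
exists x; first by rewrite !inE ntx (subsetP sPN).
apply/centP=> g Gg; apply/commgP/conjg_fixP.
have Pxg : (x ^ g)%g \in P by rewrite memJ_norm ?(subsetP nPG).
have defP : P :=: <[x]>%g.
  apply/esym/eqP; rewrite eqEcard cycle_subG Px cP -orderE /=.
  have := order_dvdG Px; rewrite cP => /(prime_nt_dvdP (isT : prime 3)) -> //.
  by rewrite order_eq1.
have ox : #[x] = 3%N by rewrite orderE -defP.
move: Pxg; rewrite defP => /cyclePmin[k]; rewrite ox.
case: k => [|[|[|]]] // _ Dxg.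
- by case/eqP: ntx; apply: (conjg_inj g); rewrite Dxg conj1g.
- have Gx : x \in G by rewrite (subsetP sNG) ?(subsetP sPN).
  have DxV : (x ^ g = x^-1)%g.
    rewrite Dxg; apply: (mulIg x); rewrite -expgSr mulVg; apply/eqP.
    by rewrite -order_dvdn ox.
  by case/eqP: ntx; apply: (odd_real_elt oddG Gx); rewrite -DxV memJ_class.
Qed.

(** With [l] the index, the two nonlinear characters are conjugate, of degree
    [d] say. Since [d] divides [#|G| = l + 2 * d ^ 2], it divides [l], so
    [d = l]. *)
Lemma card_der1_two_nonlinear (gT : finGroupType) (G : {group gT}) :
    odd #|G| -> prime #|G : G^`(1)%g| -> #|nonlinear G| = 2%N ->
  #|G^`(1)%g| = (1 + 2 * #|G : G^`(1)%g|)%N.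
Proof.
move=> oddG l_pr cNL; have [i NLi] : exists i, i \in nonlinear G.
  by apply/set0Pn; rewrite -cards_eq0 cNL.
have neq_i := nonlinear_conj_neq oddG NLi.
have defNL : nonlinear G = [set i; conjC_Iirr i].
  apply/eqP; rewrite eq_sym eqEcard cNL cards2 neq_i.
  by rewrite subUset !sub1set nonlinear_conj NLi.
have /natrP[d Dd] := Cnat_irr1 i.
have degNL : {in nonlinear G, forall j, 'chi_j 1%g = d%:R}.
  by move=> j; rewrite defNL => /set2P[]->; rewrite ?conj_irr1.
have oG := card_nonlinear_degree degNL; rewrite cNL in oG.
have d_dvd : (d %| #|G : G^`(1)%g|)%N.
  have := dvd_irr1_cardG i; rewrite Dd dvdC_nat oG.
  by rewrite dvdn_addl ?dvdn_mull ?dvdn_exp.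
have Dl : d = #|G : G^`(1)%g|.
  apply/(prime_nt_dvdP l_pr) => //; apply: contraTneq NLi => d1.
  by rewrite inE irr1_gt1 Dd d1 ltxx.
apply/eqP; rewrite -(eqn_pmul2r (indexg_gt0 G G^`(1)%g)) Lagrange ?der_sub //.
by rewrite oG Dl; apply/eqP; move: #|G : _|; lia.
Qed.

(** The nonlinear characters vanish off the derived subgroup [N], whose index
    is a prime [l]; so centralisers outside [N] have order [l] and [G] is a
    Frobenius group with kernel [N]. The possible numbers of nonlinear
    characters then determine [#|N|]. *)
Lemma few_zeros_Frobenius (gT : finGroupType) (G : {group gT}) :
    ~~ abelian G -> odd #|G| -> (11 * #|zero_entries G| < 16 * #|Iirr G|)%N ->
  [Frobenius G] /\ #|G| \in [:: 3 * 7; 3 * 13; 3 * 19; 5 * 11]%N.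
Proof.
move=> nabG oddG few; have casesl := few_nonlinear oddG few nabG.
set N := G^`(1)%G in casesl *.
have l_pr : prime #|G : N| by case: casesl => -[->].
have ntN : N :!=: 1%g by apply: contra nabG => /eqP/derG1P.
have cardC : {in G :\: N, forall x, #|'C_G[x]| = #|G : N|}.
  move=> x GNx; apply: card_cent1_vanish => [|i NLi]; first by case/setDP: GNx.
  exact: lin_orbit_trivial_vanish (lin_orbit_trivial oddG few NLi) GNx.
have [x GNx frobG] := prime_cent1_Frobenius (der_normal 1 G) ntN l_pr cardC.
have [Gx nNx] := setDP GNx.
split; first exact: FrobeniusW frobG.
rewrite -(Lagrange (der_sub 1 G)) -/N.
case: casesl => -[l_eq cNL].
- have cube1 : {in G :\: N, forall g, (g ^+ 3 = 1)%g}.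
    move=> g GNg; have [Gg _] := setDP GNg; apply/eqP.
    rewrite -order_dvdn -l_eq -(cardC g GNg) order_dvdG //.
    by rewrite in_setI Gg cent1id.
  have nilN : nilpotent N.
    apply: cube_nilpotent cube1; first exact: der_normal.
    by apply/subsetPn; exists x.
  have := index3_der1 oddG l_eq cNL nilN nabG.
  by rewrite l_eq !inE => /or3P[]/eqP->.
- by rewrite (card_der1_two_nonlinear oddG) // l_eq.
(* In the remaining case, an element of order 3 of [N] would be central, against
   the regular action of the Frobenius complement. *)
have cN : #|N| = 15%N by rewrite (card_der1_two_nonlinear oddG) // l_eq.
have [y /setD1P[nty Ny] Cy] := odd_normal_order15_cent oddG (der_normal 1 G) cN.
have sCN : 'C_G[y] \subset N.
  by apply: (Frobenius_cent1_ker frobG); rewrite inE in_set1 nty.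
case/negP: nNx; apply: (subsetP sCN).
by rewrite in_setI Gx; apply/cent1P/commute_sym; exact: (centP Cy x Gx).
Qed.

(** * Frobenius groups of order [q * p] *)

(** A Galois automorphism that raises the roots of unity of order [#[x]] to the
    power [k] maps [chi x] to [chi (x ^+ k)]. *)
Lemma char_vanish_expg (gT : finGroupType) (G : {group gT}) (chi : 'CF(G)) x k :
    chi \is a character -> x \in G -> coprime k #[x] -> chi x = 0 ->
  chi (x ^+ k)%g = 0.
Proof.
move=> Nchi Gx co_k chi_x.
have [u Du] := Qn_aut_exists co_k.
have sxG : <[x]> \subset G by rewrite cycle_subG.
pose phi := 'Res[<[x]>] chi.
have phiE y : y \in <[x]>%g -> chi y = \sum_i '[phi, 'chi_i] * 'chi_i y.
  move=> xy; rewrite -(cfResE _ sxG xy) -/phi {1}[phi]cfun_sum_cfdot sum_cfunE.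
  by apply: eq_bigr => i _; rewrite cfunE.
have := congr1 u chi_x; rewrite phiE ?cycle_id // rmorph0 => <-.
rewrite phiE ?mem_cycle // rmorph_sum; apply: eq_bigr => i _ /=.
have Li : 'chi_i \is a linear_char by apply: irr_cyclic_lin (cycle_cyclic x).
rewrite rmorphM /= [u '[_, _]]aut_natr ?Cnat_cfdot_char_irr ?cfRes_char //.
congr (_ * _); rewrite (lin_charX Li _ (cycle_id x)) Du //.
by rewrite -(lin_charX Li _ (cycle_id x)) expg_order lin_char1.
Qed.

Section PrimeDerivedSubgroup.

Variables (gT : finGroupType) (G : {group gT}) (q p : nat).
Hypotheses (q_pr : prime q) (p_pr : prime p) (lt_qp : (q < p)%N).
Hypotheses (oG' : #|G^`(1)%g| = p) (iG' : #|G : G^`(1)%g| = q).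

Let cardG : #|G| = (p * q)%N.
Proof. by rewrite -oG' -iG' Lagrange ?der_sub. Qed.

Let cycG' : cyclic G^`(1)%g.
Proof. by rewrite prime_cyclic ?oG'. Qed.

Lemma pq_irr_degree : {in nonlinear G, forall i, 'chi_i 1%g = q%:R}.
Proof.
move=> i; rewrite inE irr1_gt1.
have := irr1_le_index_abelian i (der_sub 1 G) (cyclic_abelian cycG').
rewrite iG'.
have := dvd_irr1_cardG i; have /natrP[d ->] := Cnat_irr1 i.
rewrite dvdC_nat ler_nat ltr1n => d_dvd le_dq d_gt1.
congr _%:R; apply/(prime_nt_dvdP q_pr); first by rewrite gtn_eqF.
rewrite cardG Gauss_dvdr // in d_dvd.
rewrite coprime_sym prime_coprime // gtnNdvd //; first exact: ltnW.
exact: leq_ltn_trans lt_qp.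
Qed.

(** The orbit of [i] has length 1 or [q]; if [q], the degree [q] would divide
    [p]. *)
Lemma pq_irr_vanish :
  {in nonlinear G & G :\: G^`(1)%g, forall i x, 'chi_i x = 0}.
Proof.
move=> i x NLi G'x; apply: lin_orbit_trivial_vanish G'x.
have := card_lin_orbit_stab i; rewrite iG' => oq.
have /(primeP q_pr).2 : (#|orbit (lin_action G) setT i| %| q)%N.
  by rewrite -oq dvdn_mulr.
case/pred2P=> // Oq; rewrite -iG' in Oq.
have := lin_orbit_regular_dvd Oq (pq_irr_degree NLi).
by rewrite oG' dvdn_prime2 // ltn_eqF.
Qed.

Lemma card_pq_nonlinear : p = (1 + q * #|nonlinear G|)%N.
Proof.
have := card_nonlinear_degree pq_irr_degree; rewrite cardG iG' => Dp.
apply/eqP; rewrite -(eqn_pmul2r (prime_gt0 q_pr)) Dp; apply/eqP.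
by move: #|nonlinear G| => n; lia.
Qed.

(** A zero at [x != 1] spreads to all generators of the derived subgroup, and
    the norm of the character becomes [q ^ 2 / (p * q)], which is not 1. *)
Lemma pq_irr_neq0 : {in nonlinear G & G^`(1)%g, forall i x, 'chi_i x != 0}.
Proof.
move=> i x NLi G'x; apply/negP=> /eqP chi_x.
have ntx : x != 1%g.
  by apply: contraTneq (irr1_neq0 i) => <-; rewrite chi_x eqxx.
have ox : #[x] = p.
  by apply/(prime_nt_dvdP p_pr); rewrite ?order_eq1 // -oG' order_dvdG.
have defG' : G^`(1)%g = <[x]>%g.
  by apply/esym/eqP; rewrite eqEcard cycle_subG G'x oG' -orderE ox /=.
have chi_supp : 'chi_i \in 'CF(G, 1%g).
  apply/cfun_onP=> y; rewrite in_set1 => nty.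
  have [Gy | /cfun0->//] := boolP (y \in G).
  have [G'y | nG'y] := boolP (y \in G^`(1)%g); last first.
    by apply: pq_irr_vanish; rewrite // inE nG'y.
  move: G'y; rewrite defG' => /cyclePmin[k]; rewrite ox => lt_kp Dy.
  rewrite Dy; apply: char_vanish_expg (irr_char i) _ _ chi_x.
    exact: subsetP (der_sub 1 G) x G'x.
  rewrite ox coprime_sym prime_coprime // gtnNdvd // lt0n.
  by apply: contraNneq nty => k0; rewrite Dy k0.
have := cfnormE chi_supp; rewrite cfnorm_irr big_set1 (pq_irr_degree NLi).
move/(congr1 ( *%R #|G|%:R)); rewrite mulVKf ?neq0CG // mulr1 normr_nat -natrX.
by move/eqP; rewrite eqr_nat cardG eqn_pmul2r ?prime_gt0 // gtn_eqF.
Qed.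

(** The zeros lie off the derived subgroup, where all classes have size [p]. *)
Lemma pq_nzeros i : i \in nonlinear G -> (nzeros i <= q.-1)%N.
Proof.
move=> NLi; rewrite -(leq_pmul2r (prime_gt0 p_pr)).
have sZ : {subset zero_classes i <= classes G}.
  by move=> C; rewrite inE => /andP[].
have cardC : {in zero_classes i, forall C : {set gT},
    #|C| = p /\ C \subset G :\: G^`(1)%g}.
  move=> C ZC; have /imsetP[x Gx DC] := sZ C ZC.
  rewrite DC mem_zero_classes // in ZC.
  have nG'x : x \in G :\: G^`(1)%g.
    by rewrite inE Gx andbT; apply: contraL ZC => G'x; apply: pq_irr_neq0.
  have cC := card_cent1_vanish Gx (fun j NLj => pq_irr_vanish NLj nG'x).
  split.
    apply/eqP; rewrite -(eqn_pmul2r (prime_gt0 q_pr)) -cardG -iG' -cC DC.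
    by rewrite -index_cent1 mulnC Lagrange ?subsetIl.
  rewrite DC class_sub_norm // normsD ?normG //.
  exact: normal_norm (der_normal 1 G).
have tiZ : trivIset (zero_classes i).
  apply: trivIsetS (_ : _ \subset classes G) _; first exact/subsetP.
  by case/and3P: (classes_partition G).
have sumZ : (nzeros i * p = #|cover (zero_classes i)|)%N.
  rewrite -(eqP tiZ) -sum_nat_const; apply: eq_bigr => C /cardC[]//.
have -> : (q.-1 * p = #|G :\: G^`(1)%g|)%N.
  by rewrite cardsDS ?der_sub // cardG oG' mulnC -subn1 mulnBr muln1.
rewrite sumZ subset_leq_card //; apply/bigcupsP=> C /cardC[]//.
Qed.

Lemma pq_zero_entries : (#|zero_entries G| <= #|nonlinear G| * q.-1)%N.
Proof.
rewrite card_zero_entries (bigID (mem (nonlinear G))) /= addnC big1 ?add0n.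
  by rewrite -sum_nat_const leq_sum // => i; apply: pq_nzeros.
move=> i; rewrite inE negbK => Li; apply/eqP; rewrite cards_eq0.
apply/eqP/setP=> C; rewrite !inE; apply/negP=> /andP[/imsetP[x Gx ->]].
have [y Gy ->] := repr_class G x; rewrite cfunJ //.
by rewrite (negPf (lin_char_neq0 Li Gx)).
Qed.

End PrimeDerivedSubgroup.

(** A Frobenius complement is smaller than the kernel, so the kernel has order
    [p]; its quotient has prime order [q], hence is abelian. *)
Lemma Frobenius_pq_der1 (gT : finGroupType) (G : {group gT}) q p :
    ~~ abelian G -> prime q -> prime p -> (q < p)%N ->
    [Frobenius G] -> #|G| = (q * p)%N ->
  #|G^`(1)%g| = p /\ #|G : G^`(1)%g| = q.
Proof.
move=> nabG q_pr p_pr lt_qp /existsP[H /Frobenius_kernel_exists[K frobG]] oG.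
have [defG ntK ntH _ _] := Frobenius_context frobG.
have [nsKG _ _ _] := sdprod_context defG.
have oKH : (#|K| * #|H| = q * p)%N by rewrite (sdprod_card defG).
have K_gt1 : (1 < #|K|)%N by rewrite cardG_gt1.
have H_gt1 : (1 < #|H|)%N by rewrite cardG_gt1.
have ltHK : (#|H| < #|K|)%N.
  rewrite -(ltn_predK K_gt1) ltnS; apply: dvdn_leq (Frobenius_dvd_ker1 frobG).
  by rewrite -ltnS (ltn_predK K_gt1).
have [oK oH] : #|K| = p /\ #|H| = q.
  have : (p %| #|K| * #|H|)%N by rewrite oKH dvdn_mull.
  rewrite Euclid_dvdM // => /orP[/dvdnP[m Dm] | /dvdn_leq le_pH].
    have mH : (m * #|H| = q)%N.
      by apply/eqP; rewrite -(eqn_pmul2r (prime_gt0 p_pr)) mulnAC -Dm oKH.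
    have oH : #|H| = q.
      by apply/(prime_nt_dvdP q_pr); rewrite ?gtn_eqF // -mH dvdn_mull.
    split=> //; apply/eqP; rewrite -(eqn_pmul2r (prime_gt0 q_pr)) -{1}oH oKH.
    by rewrite mulnC.
  have {}le_pH := le_pH (cardG_gt0 H).
  have := ltn_mul (leq_ltn_trans le_pH ltHK) (leq_trans lt_qp le_pH).
  by rewrite oKH mulnC ltnn.
have iK : #|G : K| = q by rewrite -divgS ?normal_sub // oG oK mulnK ?prime_gt0.
have abGK : abelian (G / K).
  by rewrite cyclic_abelian ?prime_cyclic // card_quotient ?normal_norm // iK.
have sG'K : G^`(1)%g \subset K := der1_min (normal_norm nsKG) abGK.
have oG' : #|G^`(1)%g| = p.
  apply/(prime_nt_dvdP p_pr); last by rewrite -oK cardSg.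
  by rewrite -trivg_card1; apply: contra nabG => /eqP/derG1P.
split=> //; apply/eqP; rewrite -(eqn_pmul2l (prime_gt0 p_pr)) -{1}oG'.
by rewrite Lagrange ?der_sub // oG mulnC.
Qed.

Theorem theoremB (gT : finGroupType) (G : {group gT})
    (nonabelianG : ~~ abelian G) (oddG : odd #|G|) :
  anz G < 16%:R / 11%:R <->
  [Frobenius G] /\ #|G| \in [:: 3 * 7; 3 * 13; 3 * 19; 5 * 11]%N.
Proof.
have anzE : (anz G < 16%:R / 11%:R)
          = (11 * #|zero_entries G| < 16 * #|Iirr G|)%N.
  rewrite /anz ltr_pdivrMr ?ltr0n ?card_ord // mulrAC ltr_pdivlMr ?ltr0n //.
  by rewrite -!natrM ltr_nat mulnC.
rewrite anzE; split=> [few | [frobG oG]]; first exact: few_zeros_Frobenius.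
have [q [p [[q_pr p_pr lt_qp oGqp] arith]]] : exists q p : nat,
    [/\ prime q, prime p, (q < p)%N & #|G| = (q * p)%N] /\
    (forall n, p = 1 + q * n -> 11 * (n * q.-1) < 16 * (q + n))%N.
  move: oG; rewrite !inE => /or4P[]/eqP->.
  - by exists 3%N, 7%N; split=> // n; lia.
  - by exists 3%N, 13%N; split=> // n; lia.
  - by exists 3%N, 19%N; split=> // n; lia.
  - by exists 5%N, 11%N; split=> // n; lia.
have [oG' iG'] := Frobenius_pq_der1 nonabelianG q_pr p_pr lt_qp frobG oGqp.
rewrite card_Iirr_nonlinear iG'.
apply: leq_ltn_trans (arith _ (card_pq_nonlinear q_pr p_pr lt_qp oG' iG')).
by rewrite leq_mul2l (pq_zero_entries q_pr p_pr lt_qp oG' iG') orbT.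
Qed.
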